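(* Let $n$ and $k$ be positive integers with $5k\le n$. Then there exists a latin square of order $n$ containing an indivisible $k$-plex.
   Context: A latin square of order $n$ is an $n\times n$ array of $n$ symbols in which each symbol occurs exactly once in each row and column. A $k$-plex in a latin square of order $n$ is a set of $kn$ cells containing exactly $k$ cells from each row, exactly $k$ cells from each column, and exactly $k$ occurrences of each symbol. A $k$-plex is indivisible if it contains no $c$-plex for any $c$ with $0<c<k$. *)

(* Defs.v *)
From mathcomp Require Import all_boot.
Set Implicit Arguments. Unset Strict Implicit. Unset Printing Implicit Defensive.

Definition latin_square (n : nat) (L : 'I_n -> 'I_n -> 'I_n) : Prop :=
  (forall r, injective (L r)) /\ (forall c, injective (fun r => L r c)).

Definition is_plex (n : nat) (L : 'I_n -> 'I_n -> 'I_n) (k : nat)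
  (P : {set 'I_n * 'I_n}) : Prop :=
  [/\ forall r : 'I_n, #|[set x in P | x.1 == r]| = k,
      forall c : 'I_n, #|[set x in P | x.2 == c]| = k
    & forall s : 'I_n, #|[set x in P | L x.1 x.2 == s]| = k].

Definition indivisible_plex (n : nat) (L : 'I_n -> 'I_n -> 'I_n) (k : nat)
  (P : {set 'I_n * 'I_n}) : Prop :=
  is_plex L k P /\
  forall (c : nat) (Q : {set 'I_n * 'I_n}),
    0 < c < k -> Q \subset P -> ~ is_plex L c Q.

(* Main.v *)
(** Give weights to rows, columns and symbols.  The sum of the weights of the
rows (or columns, or symbols) of the cells of a [c]-plex is [c] times the total
row (column, symbol) weight.  If the weights satisfy "row + column = symbol"
modulo some number on nearly all cells of a [k]-plex [P], a [c]-plex inside [P]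
yields a congruence on [c] which, for suitable weights, forces [k] to divide
[c].  For [k] even this is applied to the table of [Z_k * Z_2] and for [k >= 3]
odd to that of [Z_2k], each with a few rows rearranged; [P] is then an
indivisible [k]-plex in a latin square of order [2k].

A latin square [A] of order [t] sits as a corner in a latin square of any order
[n = m + t] with [m > t]: in a circulant array of order [m], the diagonals [d]
with [d < m - t] carry transversals on the old symbols and the other [t]
diagonals receive the symbols of [A].  If [m >= t + k], then [k] of those
transversals, together with an indivisible [k]-plex of [A], form an indivisible
[k]-plex of the large square, because its subplexes restrict to subplexes of
[A].  With [t <= 2k] this covers every [n >= 5k]. *)

Require Import Defs.
From mathcomp Require Import all_boot.
From mathcomp Require Import perm ssralg zmodp zify.

Set Implicit Arguments.
Unset Strict Implicit.
Unset Printing Implicit Defensive.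

Import GRing.Theory.

(** * Latin squares and plexes over finite types *)

Definition latin (T : finType) (L : T -> T -> T) : Prop :=
  (forall r, injective (L r)) /\ (forall c, injective (fun r => L r c)).

Definition plex (T : finType) (L : T -> T -> T) (k : nat) (P : {set T * T}) :
    Prop :=
  [/\ forall r, #|[set x in P | x.1 == r]| = k,
      forall c, #|[set x in P | x.2 == c]| = k
    & forall s, #|[set x in P | L x.1 x.2 == s]| = k].

Definition indivisible (T : finType) (L : T -> T -> T) (k : nat)
    (P : {set T * T}) : Prop :=
  plex L k P /\
  forall c (Q : {set T * T}), 0 < c < k -> Q \subset P -> ~ plex L c Q.

(** Arbitrary finite types allow products and disjoint unions as index sets; at ['I_n] this unfolds
    to the conclusion of the theorem. *)
Definition has_indivisible_plex (T : finType) (k : nat) : Prop :=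
  exists L : T -> T -> T, latin L /\ exists P, indivisible L k P.

Lemma plex_bij (T T' : finType) (f : T -> T') (g : T' -> T)
    (L : T -> T -> T) (L' : T' -> T' -> T') c P :
    cancel f g -> cancel g f -> (forall x y, L' (f x) (f y) = f (L x y)) ->
  plex L c P -> plex L' c [set x | (g x.1, g x.2) \in P].
Proof.
move=> fK gK fL [Pr Pc Ps].
pose G (x : T' * T') := (g x.1, g x.2).
have bG : bijective G.
  by exists (fun x => (f x.1, f x.2)) => -[x y]; rewrite /G /= ?fK ?gK.
have cardG (A : {set T * T}) : #|G @^-1: A| = #|A|.
  by apply: on_card_preimset; apply: onW_bij.
split=> i.
- rewrite -(Pr (g i)) -cardG; apply: eq_card => x.
  by rewrite !inE /= (can_eq gK).
- rewrite -(Pc (g i)) -cardG; apply: eq_card => x.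
  by rewrite !inE /= (can_eq gK).
- rewrite -(Ps (g i)) -cardG; apply: eq_card => x.
  by rewrite !inE /= -(can_eq fK) -fL !gK.
Qed.

Lemma has_indivisible_plex_card (T T' : finType) k :
  #|T| = #|T'| -> has_indivisible_plex T k -> has_indivisible_plex T' k.
Proof.
move=> eqTT' [L [[Lr Lc] [P [Pk Pind]]]].
pose f (x : T) : T' := enum_val (cast_ord eqTT' (enum_rank x)).
pose g (y : T') : T := enum_val (cast_ord (esym eqTT') (enum_rank y)).
have fK : cancel f g by move=> x; rewrite /f /g enum_valK cast_ordK enum_rankK.
have gK : cancel g f by move=> x; rewrite /f /g enum_valK cast_ordKV enum_rankK.
pose L' x y := f (L (g x) (g y)).
have fL x y : L' (f x) (f y) = f (L x y) by rewrite /L' !fK.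
exists L'; split.
  split=> [r c c' | c r r'] /(can_inj fK).
    by move=> /Lr /(can_inj gK).
  by move=> /Lc /(can_inj gK).
exists [set x | (g x.1, g x.2) \in P]; split; first exact: plex_bij fK gK fL Pk.
move=> c Q ck QP Qc.
apply: (Pind c [set x | (f x.1, f x.2) \in Q] ck).
  by apply/subsetP=> -[x y]; rewrite inE => /(subsetP QP); rewrite inE /= !fK.
by apply: (plex_bij gK fK _ Qc) => x y; rewrite /L' fK.
Qed.

(** * Counting cells of a plex *)

Lemma card_rel (T : finType) (q : T -> T -> bool) :
  #|[set x | q x.1 x.2]| = \sum_r \sum_c q r c.
Proof.
rewrite pair_big -sum1dep_card big_mkcond; apply: eq_bigr => -[x y] _ /=.
by case: (q x y).
Qed.

(* [M r s] is the column in which the symbol [s] occurs in row [r]. *)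
Lemma plex_of_rows (T : finType) (L M : T -> T -> T) (p : T -> T -> bool) k :
    (forall r s, L r (M r s) = s) -> (forall r, injective (L r)) ->
    (forall r, \sum_c p r c = k) -> (forall c, \sum_r p r c = k) ->
    (forall s, \sum_r p r (M r s) = k) ->
  plex L k [set x | p x.1 x.2].
Proof.
move=> LM Linj pr pc ps.
have card_and (q : T * T -> bool) :
    #|[set x in [set x | p x.1 x.2] | q x]| = \sum_r \sum_c (p r c && q (r, c)).
  rewrite -(card_rel (fun r c => p r c && q (r, c))).
  by apply: eq_card => -[x y]; rewrite !inE.
split=> i; rewrite card_and /=.
- rewrite (bigD1 i) //= [X in _ + X]big1 ?addn0 => [|r /negPf ri].
    by rewrite -[RHS](pr i); apply: eq_bigr => c _; rewrite eqxx andbT.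
  by apply: big1 => c _; rewrite ri andbF.
- rewrite -(pc i); apply: eq_bigr => r _.
  rewrite (bigD1 i) //= eqxx andbT big1 ?addn0 // => c /negPf ->.
  by rewrite andbF.
- rewrite -(ps i); apply: eq_bigr => r _.
  rewrite (bigD1 (M r i)) //= LM eqxx andbT big1 ?addn0 // => c.
  by rewrite -(inj_eq (Linj r)) LM => /negPf ->; rewrite andbF.
Qed.

Lemma plex_sum (T : finType) (L : T -> T -> T) c (Q : {set T * T})
    (f : T -> nat) : plex L c Q ->
  [/\ \sum_(x in Q) f x.1 = c * \sum_r f r,
      \sum_(x in Q) f x.2 = c * \sum_r f r
    & \sum_(x in Q) f (L x.1 x.2) = c * \sum_r f r].
Proof.
have H (q : T * T -> T) : (forall i, #|[set x in Q | q x == i]| = c) ->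
    \sum_(x in Q) f (q x) = c * \sum_r f r.
  move=> Qq; rewrite (partition_big q xpredT) //= big_distrr /=.
  apply: eq_bigr => i _; rewrite -(Qq i) -sum_nat_const.
  by apply: eq_big => [x | x /andP[_ /eqP ->]] //; rewrite inE.
by case=> Q1 Q2 Q3; split; apply: H.
Qed.

(** * Sums over initial segments *)

Ltac split_ifs_lia :=
  repeat match goal with |- context [if ?b then _ else _] =>
    lazymatch b with
    | context [if _ then _ else _] => fail
    | _ => case: (boolP b) => ?
    end
  end; lia.

Lemma sum_interval a b n : \sum_(i < n) (a <= i < b) = minn b n - a.
Proof.
elim: n => [|n IHn]; first by rewrite big_ord0; lia.
by rewrite big_ord_recr /= IHn; lia.
Qed.

Lemma sum_pred1 a n : \sum_(i < n) (i == a :> nat) = (a < n).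
Proof.
elim: n => [|n IHn]; first by rewrite big_ord0.
by rewrite big_ord_recr /= IHn; lia.
Qed.

Lemma sum_odd n b : \sum_(i < n) (b == odd i) = (n + ~~ b)./2.
Proof.
elim: n => [|n IHn]; first by rewrite big_ord0; case: b.
by rewrite big_ord_recr /= IHn; case: (b); lia.
Qed.

Lemma sum_ord_double n : (\sum_(i < n) i).*2 = n * n.-1.
Proof.
elim: n => [|n IHn]; first by rewrite big_ord0.
by rewrite big_ord_recr doubleD IHn /=; case: n {IHn} => //= n; lia.
Qed.

(** The regular selection pattern of the odd construction, counted along a column and along a
    symbol; any four consecutive rows contribute 2. *)
Lemma sum_mod4 h b :
  \sum_(i < (4 * h).+2) (b (+) (0 < i %% 4 < 3)) = (2 * h).+1 /\
  \sum_(i < (4 * h).+2) (b (+) (1 < i %% 4)) = 2 * (h + b).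
Proof.
elim: h => [|h [IH1 IH2]].
  by rewrite !muln0 !big_ord_recr !big_ord0; case: b.
by rewrite mulnS; split; rewrite 4!big_ord_recr /= ?IH1 ?IH2; case: (b); lia.
Qed.

(** Rows 0, 1, 2 and 4 are the irregular ones of the odd construction. *)
Lemma sum_eq_but_0124 (F G : nat -> nat) n : 4 < n ->
    (forall i, 2 < i < n -> i != 4 -> F i = G i) ->
  \sum_(i < n) F i + (G 0 + G 1 + G 2 + G 4) =
  \sum_(i < n) G i + (F 0 + F 1 + F 2 + F 4).
Proof.
case: n => [|[|[|[|[|n]]]]] // _ FG.
rewrite 2!(big_ord_recl n.+4) 2!(big_ord_recl n.+3) 2!(big_ord_recl n.+2) /=.
rewrite 2!(big_ord_recl n.+1) 2!(big_ord_recl n) /= /bump /= !add1n (FG 3) //.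
rewrite (eq_bigr (fun i : 'I_n => G (1 + (1 + (1 + (1 + (1 + i)))))));
  first by lia.
by move=> i _; rewrite FG //=; have := ltn_ord i; lia.
Qed.

Lemma sum_bool_pair (I : finType) (F : I * bool -> nat) :
  \sum_x F x = \sum_i (F (i, true) + F (i, false)).
Proof.
rewrite (eq_bigr (fun i => \sum_b F (i, b))) => [|i _].
  by rewrite pair_big; apply: eq_bigr => -[].
by rewrite big_bool.
Qed.


(** * The square of order [2k], [k] even *)

Section EvenOrder.

Variable h : nat.
Local Notation k := (h.*2.+2).
Local Notation T := ('I_k * bool)%type.

(* The rows of [Z_k * Z_2] with indices [(0, 0)] and [(1, 0)] are exchanged on
   the columns [(j, 0)]. *)
Definition even_row (i : 'I_k) (e f : bool) : 'I_k :=
  if e || f then i else tperm ord0 (inord 1) i.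

Definition even_square (x y : T) : T :=
  ((even_row x.1 x.2 y.2 + y.1)%R, x.2 (+) y.2).

Definition even_col (x s : T) : T :=
  ((s.1 - even_row x.1 x.2 (x.2 (+) s.2))%R, x.2 (+) s.2).

Definition even_cells (x y : T) : bool := y.2 == ~~ odd x.1.

Lemma even_latin : latin even_square.
Proof.
split=> [[i e] [j f] [j' f']|[j f] [i e] [i' e']] /eqP; rewrite xpair_eqE /=.
  by case/andP=> /eqP + /eqP/addbI eqf; rewrite eqf => /addrI ->.
case/andP=> /eqP/addIr + /eqP/addIb eqe; rewrite eqe /even_row.
by case: ifP => _; [move=> -> | move=> /perm_inj ->].
Qed.

Lemma even_colK x s : even_square x (even_col x s) = s.
Proof.
case: x s => [i e] [j f]; rewrite /even_square /even_col /=.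
by rewrite addrC subrK addKb.
Qed.

(** A column meets both rows [(j, _)] for the [h.+1] indices [j] of one parity; a symbol is selected
    in exactly one of the two rows [(j, _)] for every [j]. *)
Lemma even_plex : plex even_square k [set x | even_cells x.1 x.2].
Proof.
have half b : \sum_(i < k) (b == odd i) = h.+1.
  by rewrite sum_odd; case: b; lia.
apply: plex_of_rows even_colK even_latin.1 _ _ _ => -[i e];
  rewrite sum_bool_pair /even_cells /=.
- rewrite (eq_bigr (fun=> 1)) ?sum1_card ?card_ord // => j _.
  by case: odd.
- rewrite big_split /= -[RHS]/(h.+1.*2) -(addnn h.+1); congr (_ + _);
  rewrite -[RHS](half (~~ e)); apply: eq_bigr => j _;
  by case: e; case: odd.
- rewrite (eq_bigr (fun=> 1)) ?sum1_card ?card_ord // => j _.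
  by case: odd; case: e.
Qed.

(** Columns and symbols have the same total weight, so [k] divides [c] times the total row weight.
    That total is [k * k.-1 - 1], one unit being lost on the row [(1, 0)], whence [k] divides
    [c]. *)
Lemma even_indivisible : indivisible even_square k [set x | even_cells x.1 x.2].
Proof.
split; first exact: even_plex.
move=> c Q /andP[c0 ck] QP cQ.
pose lab (x : T) : nat := x.1.
(* Both exchanged rows have weight 0: their cells in [P] lie in the columns
   [(j, 1)] and [(j, 0)] respectively, where the symbol is [(j, _)]. *)
pose row (x : T) : nat := if x == (inord 1, false) then 0 else x.1.
have v1 : (inord 1 : 'I_k) = 1 :> nat by rewrite inordK.
have cellE x : x \in Q -> row x.1 + lab x.2 =
    lab (even_square x.1 x.2) + (row x.1 + lab x.2) %/ k * k.
  case: x => [[i e] [j f]] /(subsetP QP); rewrite inE /even_cells /= => /eqP ->.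
  have -> : lab (even_square (i, e) (j, ~~ odd i)) = (row (i, e) + j) %% k.
    rewrite /lab /row /even_square /even_row xpair_eqE eqbF_neg /=.
    case: e => /=; first by rewrite andbF.
    case: tpermP => [->|->|/eqP i0 /eqP i1].
    - by rewrite /= -val_eqE /= v1.
    - by rewrite /= v1 eqxx.
    - by rewrite (negPf i1); case: ifP.
  by rewrite [RHS]addnC; exact: divn_eq.
have [sr _ _] := plex_sum row cQ; have [_ sc ss] := plex_sum lab cQ.
have : c * \sum_x row x + c * \sum_x lab x =
       c * \sum_x lab x + (\sum_(x in Q) (row x.1 + lab x.2) %/ k) * k.
  rewrite -sr -{1}sc -ss big_distrl /= -!big_split.
  exact: eq_bigr.
rewrite addnC => /addnI.
have -> : \sum_x row x = (k * k.-1).-1.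
  have -> : k * k.-1 = \sum_x lab x.
    rewrite sum_bool_pair /lab /= big_split /= addnn.
    exact/esym/sum_ord_double.
  rewrite (bigD1 (inord 1, false)) //= [in RHS](bigD1 (inord 1, false)) //=.
  rewrite /row eqxx /lab /= v1 add0n add1n /=; apply: eq_bigr => x.
  by move=> /negPf ->.
move=> E; have : k %| c * (k * k.-1) by rewrite dvdn_mull ?dvdn_mulr.
have -> : c * (k * k.-1) = c * (k * k.-1).-1 + c by nia.
rewrite E dvdn_addr ?dvdn_mull // => /(dvdn_leq c0).
by rewrite leqNgt ck.
Qed.

End EvenOrder.

(** * The square of order [2k], [k = 2h + 1] odd *)

Section OddOrder.

Variable h : nat.
Hypothesis h_gt0 : 0 < h.
Local Notation t := ((4 * h).+2).

(** The involution of [Z_t] exchanging [2i - 1] and [2i]; [flip_even] exchanges [2i] and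
    [2i + 1]. *)
Definition flip_odd c :=
  if odd c then if c == (4 * h).+1 then 0 else c.+1
  else if c == 0 then (4 * h).+1 else c.-1.

Definition flip_even c := if odd c then c.-1 else c.+1.

(* Row [r] of the table of [Z_t] is [c |-> r + c]; only the rows [0], [1] and
   [-1] are changed.  In column [c] they contain [c - 1], [c] and [c + 1] in an
   order depending on [c]. *)
Definition odd_entry r c :=
  if r == 0 then if 0 < c <= 2 * h then c else flip_odd c
  else if r == 1 then if 0 < c <= 2 * h then flip_odd c else c
  else if r == (4 * h).+1 then flip_even c
  else if r + c < t then r + c else r + c - t.

(** The changed rows are involutions, since [flip_odd] preserves the interval from 1 to [2 * h]; the
    other rows invert to [s - r] modulo [t]. *)
Definition odd_entry_inv r s :=
  if r == 0 then if 0 < s <= 2 * h then s else flip_odd s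
  else if r == 1 then if 0 < s <= 2 * h then flip_odd s else s
  else if r == (4 * h).+1 then flip_even s
  else if r <= s then s - r else s + t - r.

(* Apart from the rows [0], [1] and two exchanges in the rows [2] and [4], a row
   selects all columns of one parity. *)
Definition odd_cell r c : bool :=
  if r == 0 then (0 < c <= 2 * h) || (c == (4 * h).+1)
  else if r == 1 then (2 * h < c <= 4 * h) || (c == 2)
  else if r == 2 then (~~ odd c && (c != 2)) || (c == (4 * h).-1)
  else if r == 4 then (odd c && (c != (4 * h).-1)) || (c == 0)
  else odd c (+) (0 < r %% 4 < 3).

Lemma odd_entry_lt r c : r < t -> c < t -> odd_entry r c < t.
Proof. rewrite /odd_entry /flip_odd /flip_even => rt ct; split_ifs_lia. Qed.

Lemma odd_entry_inv_lt r s : r < t -> s < t -> odd_entry_inv r s < t.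
Proof. rewrite /odd_entry_inv /flip_odd /flip_even => rt st; split_ifs_lia. Qed.

Lemma odd_entryK r c : r < t -> c < t -> odd_entry_inv r (odd_entry r c) = c.
Proof.
rewrite /odd_entry /odd_entry_inv /flip_odd /flip_even => rt ct.
split_ifs_lia.
Qed.

Lemma odd_entry_invK r s :
  r < t -> s < t -> odd_entry r (odd_entry_inv r s) = s.
Proof.
rewrite /odd_entry /odd_entry_inv /flip_odd /flip_even => rt st.
split_ifs_lia.
Qed.

Lemma odd_entry_inj_row c r r' : c < t -> r < t -> r' < t ->
  odd_entry r c = odd_entry r' c -> r = r'.
Proof.
rewrite /odd_entry /flip_odd /flip_even => ct rt rt'.
split_ifs_lia.
Qed.

Lemma sum_odd_cell_row r : r < t -> \sum_(c < t) odd_cell r c = (2 * h).+1.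
Proof.
move=> rt.
(* Each irregular row is [B + C - A] for an interval or parity class [B] and at most one cell in
   each of [C] and [A]. *)
have sum_cells (A B C : nat -> nat) :
    (forall c, c < t -> odd_cell r c + A c = B c + C c) ->
    \sum_(c < t) odd_cell r c + \sum_(c < t) A c =
    \sum_(c < t) B c + \sum_(c < t) C c.
  by move=> E; rewrite -!big_split; apply: eq_bigr => c _; apply: E.
have [r0|r0] := eqVneq r 0.
  have := @sum_cells (fun=> 0) (fun c => 0 < c < (2 * h).+1)
    (fun c => c == (4 * h).+1).
  rewrite sum_interval sum_pred1 sum_nat_const muln0 r0 /odd_cell /=.
  by move=> E; rewrite -[LHS]addn0 E => [|c]; lia.
have [r1|r1] := eqVneq r 1.
  have := @sum_cells (fun=> 0) (fun c => 2 * h < c < (4 * h).+1)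
    (fun c => c == 2).
  rewrite sum_interval sum_pred1 sum_nat_const muln0 r1 /odd_cell /=.
  by move=> E; rewrite -[LHS]addn0 E => [|c]; lia.
have [r2|r2] := eqVneq r 2.
  have := @sum_cells (fun c => c == 2) (fun c => false == odd c)
    (fun c => c == (4 * h).-1).
  rewrite !sum_pred1 sum_odd r2 /odd_cell /= => E.
  by apply/eqP; rewrite -(eqn_add2r (2 < t)) E => [|c]; lia.
have [r4|r4] := eqVneq r 4.
  have := @sum_cells (fun c => c == (4 * h).-1) (fun c => true == odd c)
    (fun c => c == 0).
  rewrite !sum_pred1 sum_odd r4 /odd_cell /= => E.
  by apply/eqP; rewrite -(eqn_add2r ((4 * h).-1 < t)) E => [|c]; lia.
rewrite (eq_bigr (fun c : 'I_t => (~~ (0 < r %% 4 < 3) == odd c) : nat)).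
  by rewrite sum_odd; lia.
move=> c _; rewrite /odd_cell (negPf r0) (negPf r1) (negPf r2) (negPf r4).
by case: odd; case: (_ < _ < _).
Qed.

Lemma sum_odd_cell_col c : c < t -> \sum_(r < t) odd_cell r c = (2 * h).+1.
Proof.
move=> ct.
have t4 : 4 < t by lia.
have FG r : 2 < r < t -> r != 4 ->
    odd_cell r c = odd c (+) (0 < r %% 4 < 3) :> nat.
  by case: r => [|[|[|[|[|r]]]]].
have := sum_eq_but_0124 t4 FG; rewrite (sum_mod4 h (odd c)).1.
(* In every column the four irregular rows select two cells, just as the regular pattern would. *)
suff <- : odd_cell 0 c + odd_cell 1 c + odd_cell 2 c + odd_cell 4 c =
  (odd c (+) false) + (odd c (+) true) + (odd c (+) true) + (odd c (+) false).
  by move/addIn.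
rewrite /odd_cell /=.
have [->|c0] := eqVneq c 0; first by lia.
have [->|c2] := eqVneq c 2; first by lia.
have [->|c3] := eqVneq c (4 * h).-1; first by lia.
have [->|c1] := eqVneq c (4 * h).+1; first by lia.
case: (odd c); lia.
Qed.

(** In a regular row [r] the symbol [s] lies in a column of the parity of [s + r], which turns the
    pattern [0 < r %% 4 < 3] into [1 < r %% 4]. For [s] even (odd) this would give [2h] ([2h + 2])
    cells, of which 1 (3) in rows 0, 1, 2 and 4; those rows really contribute 2. *)
Lemma sum_odd_cell_sym s : s < t ->
  \sum_(r < t) odd_cell r (odd_entry_inv r s) = (2 * h).+1.
Proof.
move=> st.
have t4 : 4 < t by lia.
have FG r : 2 < r < t -> r != 4 ->
    odd_cell r (odd_entry_inv r s) = odd s (+) (1 < r %% 4) :> nat.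
  move=> rt r4; congr nat_of_bool; have [r2 rt'] := andP rt.
  have -> : odd_cell r (odd_entry_inv r s) =
      odd (odd_entry_inv r s) (+) (0 < r %% 4 < 3).
    by case: r {rt rt'} r2 r4 => [|[|[|[|[|r]]]]].
  rewrite /odd_entry_inv /flip_even; case: eqVneq => [|_]; first by lia.
  case: eqVneq => [|_]; first by lia.
  have [rX|rX] := eqVneq r (4 * h).+1.
    by rewrite rX; case: (boolP (odd s)) => os; lia.
  have -> : odd (if r <= s then s - r else s + t - r) = odd s (+) odd r.
    by case: leqP => rs; lia.
  rewrite -addbA; congr addb; lia.
have := sum_eq_but_0124 t4 FG; rewrite (sum_mod4 h (odd s)).2.
have -> : odd_cell 0 (odd_entry_inv 0 s) + odd_cell 1 (odd_entry_inv 1 s) +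
    odd_cell 2 (odd_entry_inv 2 s) + odd_cell 4 (odd_entry_inv 4 s) = 2.
  (* The corrections at the symbols 1, 4 and [4h + 1] cancel when the three identities are added. *)
  have rows01 : odd_cell 0 (odd_entry_inv 0 s) + odd_cell 1 (odd_entry_inv 1 s)
      + (s == (4 * h).+1) = 1 + (s == 1).
    by rewrite /odd_cell /odd_entry_inv /flip_odd /=; split_ifs_lia.
  have row2 : odd_cell 2 (odd_entry_inv 2 s) + (s == 4) =
      ~~ odd s + (s == (4 * h).+1).
    rewrite /odd_cell /=; set x := odd_entry_inv 2 s.
    have xE : x = if 2 <= s then s - 2 else s + t - 2.
      by rewrite /x /odd_entry_inv /=; case: eqVneq => // ?; lia.
    have -> : odd x = odd s by rewrite xE; split_ifs_lia.
    have -> : (x == 2) = (s == 4) by rewrite xE; split_ifs_lia.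
    have -> : (x == (4 * h).-1) = (s == (4 * h).+1).
      by rewrite xE; split_ifs_lia.
    have : ((s == (4 * h).+1) ==> odd s) && ((s == 4) ==> ~~ odd s) by lia.
    by case: (odd s); case: (s == 4); case: (s == _).
  have row4 : odd_cell 4 (odd_entry_inv 4 s) + (s == 1) = odd s + (s == 4).
    rewrite /odd_cell /=; set x := odd_entry_inv 4 s.
    have xE : x = if 4 <= s then s - 4 else s + t - 4.
      by rewrite /x /odd_entry_inv /=; case: eqVneq => // ?; lia.
    have -> : odd x = odd s by rewrite xE; split_ifs_lia.
    have -> : (x == 0) = (s == 4) by rewrite xE; split_ifs_lia.
    have -> : (x == (4 * h).-1) = (s == 1) by rewrite xE; split_ifs_lia.
    have : ((s == 1) ==> odd s) && ((s == 4) ==> ~~ odd s) by lia.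
    by case: (odd s); case: (s == 4); case: (s == 1).
  move: rows01 row2 row4; clear; case: (odd s); lia.
by case: (odd s); lia.
Qed.

Definition odd_square (r c : 'I_t) : 'I_t := inord (odd_entry r c).

Definition odd_col (r s : 'I_t) : 'I_t := inord (odd_entry_inv r s).

Lemma odd_squareE r c : odd_square r c = odd_entry r c :> nat.
Proof. by rewrite inordK // odd_entry_lt. Qed.

Lemma odd_colE r s : odd_col r s = odd_entry_inv r s :> nat.
Proof. by rewrite inordK // odd_entry_inv_lt. Qed.

Lemma odd_colK r s : odd_square r (odd_col r s) = s.
Proof. by apply: val_inj; rewrite /= odd_squareE odd_colE odd_entry_invK. Qed.

Lemma odd_latin : latin odd_square.
Proof.
split=> [r c c' | c r r'] /(congr1 val); rewrite /= !odd_squareE => E.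
  apply: val_inj; rewrite /= -(odd_entryK (ltn_ord r) (ltn_ord c)) E.
  by rewrite odd_entryK.
exact: val_inj (odd_entry_inj_row (ltn_ord c) (ltn_ord r) (ltn_ord r') E).
Qed.

Definition odd_cells : {set 'I_t * 'I_t} :=
  [set x : 'I_t * 'I_t | odd_cell x.1 x.2].

Lemma odd_plex : plex odd_square (2 * h).+1 odd_cells.
Proof.
apply: (plex_of_rows (p := fun r c : 'I_t => odd_cell r c) odd_colK
  odd_latin.1) => i.
- exact: sum_odd_cell_row.
- exact: sum_odd_cell_col.
- rewrite -(sum_odd_cell_sym (ltn_ord i)); apply: eq_bigr => r _.
  by rewrite odd_colE.
Qed.

(* With these weights modulo [t], the only selected cells violating
   "row + column = symbol" are [(0, t - 1)] and [(1, 2)], with opposite odd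
   defects [1] and [-1]; parity shows that a subplex contains both or none. *)
Definition odd_label r :=
  if r == 1 then 0 else if r == (4 * h).+1 then 1 else r.

Lemma sum_odd_label : \sum_(r < t) odd_label r = 2 * h * (4 * h).+1.
Proof.
have E : \sum_(r < (4 * h).+1) odd_label r +
    \sum_(r < (4 * h).+1) (r == 1 :> nat) = \sum_(r < (4 * h).+1) r.
  rewrite -big_split; apply: eq_bigr => r _ /=.
  by rewrite /odd_label; have := ltn_ord r; split_ifs_lia.
have last : odd_label (4 * h).+1 = 1 by rewrite /odd_label; split_ifs_lia.
rewrite sum_pred1 (_ : 1 < _ = true) in E; last by lia.
rewrite big_ord_recr /= last.
have /= := sum_ord_double (4 * h).+1; rewrite -E.
by move: (\sum_(r < _) _) => S D; apply: double_inj; rewrite D; lia.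
Qed.

Definition odd_wrap r c : bool :=
  if r == 0 then c == (4 * h).+1 else if r == (4 * h).+1 then false
  else t <= r + c.

(** Apart from the two defects, the selected cells of rows 0 and 1 contain their own column index,
    and row [-1] selects even columns [c], with entry [c + 1]; this explains the labels 0, 0 and
    1. *)
Lemma odd_cell_weight r c : r < t -> c < t -> odd_cell r c ->
  odd_label r + c + ((r == 0) && (c == (4 * h).+1)) =
  odd_entry r c + odd_wrap r c * t + ((r == 1) && (c == 2)).
Proof.
rewrite /odd_cell /odd_label /odd_entry /odd_wrap => rt ct.
have [->|r0] := eqVneq r 0.
  by rewrite /flip_odd /=; split_ifs_lia.
have [->|r1] := eqVneq r 1.
  by rewrite /flip_odd /=; split_ifs_lia.
have [->|rX] := eqVneq r (4 * h).+1.
  by rewrite /flip_even; split_ifs_lia.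
by move=> _; rewrite (leqNgt t); case: ltnP => ?; lia.
Qed.

(** The total label [2h(4h + 1)] and the modulus [t] are even, so the defects cancel. The total is
    also 1 modulo [2h + 1], which divides [t] and hence [c]. *)
Lemma odd_indivisible : indivisible odd_square (2 * h).+1 odd_cells.
Proof.
split; first exact: odd_plex.
move=> c Q /andP[c0 ck] QP cQ.
have sum1_mem y : \sum_(x in Q) (x == y) = (y \in Q).
  have [yQ|yQ] := boolP (y \in Q).
    rewrite (bigD1 y) //= eqxx big1 // => x /andP[_ /negPf ->] //.
  by rewrite big1 // => x xQ; case: eqP yQ => // <-; rewrite xQ.
pose e1 : 'I_t * 'I_t := (inord 0, inord (4 * h).+1).
pose e2 : 'I_t * 'I_t := (inord 1, inord 2).
have cellE (x : 'I_t * 'I_t) : x \in Q ->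
    odd_label x.1 + x.2 + (x == e1) =
    odd_square x.1 x.2 + odd_wrap x.1 x.2 * t + (x == e2).
  move=> /(subsetP QP); rewrite inE => /odd_cell_weight -/(_ _ _) E.
  move: (E (ltn_ord _) (ltn_ord _)); rewrite odd_squareE; case: x {E} => r s /=.
  by rewrite !xpair_eqE -!val_eqE /= !inordK //; lia.
have [sr _ _] := plex_sum (fun r : 'I_t => odd_label r) cQ.
have [_ sc ss] := plex_sum (fun r : 'I_t => nat_of_ord r) cQ.
have : c * (2 * h * (4 * h).+1) + c * \sum_(r < t) r + (e1 \in Q) =
    c * \sum_(r < t) r + (\sum_(x in Q) odd_wrap x.1 x.2) * t + (e2 \in Q).
  rewrite -sum_odd_label -sr -{1}sc -ss -!sum1_mem big_distrl /= -!big_split.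
  exact: eq_bigr.
move: (\sum_(x in Q) _) (\sum_r _) (e1 \in Q) (e2 \in Q) => W S a b E.
have ab : a = b.
  have t_even : odd t = false by rewrite /= negbK oddM.
  have := congr1 odd E; rewrite !oddD !oddM t_even !oddb.
  by rewrite !andbF addbF => /addbI.
have {}E : c * (2 * h * (4 * h).+1) = W * t by rewrite ab in E; lia.
have : (2 * h).+1 %| c.
  rewrite -(@dvdn_addr (c * (2 * h).+1 * (2 * (2 * h).+1))).
    have -> : c * (2 * h).+1 * (2 * (2 * h).+1) + c =
       (2 * W + 3 * c) * (2 * h).+1 by nia.
    exact: dvdn_mull.
  by rewrite -mulnA mulnCA dvdn_mulr.
by move=> /(dvdn_leq c0); rewrite leqNgt ck.
Qed.

End OddOrder.

(** * Extending a corner *)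

Section Extension.

Variables m' w k : nat.
Local Notation m := m'.+1.
Local Notation U := {d : 'I_m | w <= d}.
Local Notation T := ('I_m + U)%type.
Hypotheses (le_wm : w <= m') (le_kw : k <= w).

(* For [m] odd the permutations are [d |-> 2d] and the identity.  For [m] even,
   [Z_m] has no complete mapping, and [row_val d = d + col_val d] modulo [m]
   holds for all [d] but [m - 1]. *)
Definition row_val d := if d.*2 < m then d.*2 else d.*2 + ~~ odd m - m.

Definition col_val d :=
  if d.*2 < m then d
  else if ~~ odd m && (d == m') then m./2 else d + ~~ odd m.

Lemma row_val_lt d : d < m -> row_val d < m.
Proof. by rewrite /row_val => ?; case: ifP; lia. Qed.

Lemma col_val_lt d : d < m -> col_val d < m.
Proof. by rewrite /col_val => ?; do 2?case: ifP; lia. Qed.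

Definition row_shift (d : 'I_m) : 'I_m := inord (row_val d).

Definition col_shift (d : 'I_m) : 'I_m := inord (col_val d).

Lemma row_shift_inj : injective row_shift.
Proof.
move=> d e /(congr1 val); rewrite /= !inordK ?row_val_lt //.
move=> E; apply: val_inj; move: E (ltn_ord d) (ltn_ord e); rewrite /row_val /=.
by do 2?case: ifP; lia.
Qed.

Lemma col_shift_inj : injective col_shift.
Proof.
move=> d e /(congr1 val); rewrite /= !inordK ?col_val_lt //.
move=> E; apply: val_inj; move: E (ltn_ord d) (ltn_ord e); rewrite /col_val /=.
by do 4?case: ifP; lia.
Qed.

(** This makes the entry [r + row_shift d] on a diagonal [d = c - r] equal to [c + col_shift d];
    [d < w <= m'] avoids the exceptional [d = m - 1]. *)
Lemma row_shiftE (d : 'I_m) : d < w -> row_shift d = (d + col_shift d)%R.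
Proof.
move=> dw; apply: val_inj; rewrite /= !inordK ?row_val_lt ?col_val_lt //.
have dm := ltn_ord d; rewrite /row_val /col_val.
case: ifP => d2; first by rewrite addnn modn_small.
case: ifP => dm'; first by lia.
have -> : d + (d + ~~ odd m) = d.*2 + ~~ odd m - m + m by lia.
by rewrite modnDr modn_small //; lia.
Qed.

(** An element [u] of [U] is at once a diagonal, the new symbol filling it, and the new row and
    column that take up the old symbols displaced from it. *)
Definition extend (A : U -> U -> U) (x y : T) : T :=
  match x, y with
  | inl r, inl c =>
      if insub (c - r)%R is Some u then inr u
      else inl (r + row_shift (c - r))%R
  | inl r, inr u => inl (r + row_shift (val u))%R
  | inr u, inl c => inl (c + col_shift (val u))%R
  | inr u, inr v => inr (A u v)
  end.

Lemma extend_small A (r d : 'I_m) : d < w ->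
  extend A (inl r) (inl (r + d)%R) = inl (r + row_shift d)%R.
Proof.
move=> dw; rewrite /extend (addrC r) addrK.
by case: insubP => [u|]; rewrite // leqNgt dw.
Qed.

Lemma extend_large A (r : 'I_m) (u : U) :
  extend A (inl r) (inl (r + val u)%R) = inr u.
Proof. by rewrite /extend (addrC r) addrK valK. Qed.

Lemma extend_small_col A (c d : 'I_m) : d < w ->
  extend A (inl (c - d)%R) (inl c) = inl (c + col_shift d)%R.
Proof.
by move=> dw; rewrite -{2}(subrK d c) extend_small // row_shiftE // addrA subrK.
Qed.

Lemma extend_large_col A (c : 'I_m) (u : U) :
  extend A (inl (c - val u)%R) (inl c) = inr u.
Proof. by rewrite -{2}(subrK (val u) c) extend_large. Qed.

Variant row_spec (r : 'I_m) : 'I_m -> Prop :=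
  | RowSmall (d : 'I_m) of d < w : row_spec r (r + d)%R
  | RowLarge (u : U) : row_spec r (r + val u)%R.

Variant col_spec (c : 'I_m) : 'I_m -> Prop :=
  | ColSmall (d : 'I_m) of d < w : col_spec c (c - d)%R
  | ColLarge (u : U) : col_spec c (c - val u)%R.

Lemma rowP r c : row_spec r c.
Proof.
rewrite -[c](subrK r) addrC.
have [wd|dw] := leqP w (c - r)%R; last exact: RowSmall.
exact: (RowLarge r (Sub (c - r)%R wd : U)).
Qed.

Lemma colP c r : col_spec c r.
Proof.
rewrite -[r](subKr c).
have [wd|dw] := leqP w (c - r)%R; last exact: ColSmall.
exact: (ColLarge c (Sub (c - r)%R wd : U)).
Qed.

Lemma extend_latin A : latin A -> latin (extend A).
Proof.
have valU (u : U) : (val u < w) = false by rewrite ltnNge (valP u).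
have inlI : injective (@inl 'I_m U) by move=> a b [].
have inrI : injective (@inr 'I_m U) by move=> a b [].
move=> [Ar Ac]; split=> [[r|u] y y' | [c|u] x x'].
- case: y => [c|v]; [case: (rowP r c) => [d dw|u]|];
    (case: y' => [c'|v']; [case: (rowP r c') => [d' dw'|u']|]);
    rewrite ?(extend_small _ _ dw) ?(extend_small _ _ dw') ?extend_large //=.
  + by move/inlI/addrI/row_shift_inj => ->.
  + by move/inlI/addrI/row_shift_inj => E; rewrite E valU in dw.
  + by move/inrI => ->.
  + by move/inlI/addrI/row_shift_inj => E; rewrite -E valU in dw'.
  + by move/inlI/addrI/row_shift_inj/val_inj => ->.
- case: y y' => [c|v] [c'|v'] //=.
  + by move/inlI/addIr => ->.
  + by move/inrI/Ar => ->.
- case: x => [r|v]; [case: (colP c r) => [d dw|u]|];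
    (case: x' => [r'|v']; [case: (colP c r') => [d' dw'|u']|]);
    rewrite ?(extend_small_col _ _ dw) ?(extend_small_col _ _ dw')
            ?extend_large_col //=.
  + by move/inlI/addrI/col_shift_inj => ->.
  + by move/inlI/addrI/col_shift_inj => E; rewrite E valU in dw.
  + by move/inrI => ->.
  + by move/inlI/addrI/col_shift_inj => E; rewrite -E valU in dw'.
  + by move/inlI/addrI/col_shift_inj/val_inj => ->.
- case: x x' => [r|v] [r'|v'] //=.
  + by move/inlI/addIr => ->.
  + by move/inrI/Ac => ->.
Qed.

Definition extend_cell (P : {set U * U}) (x : T * T) : bool :=
  match x with
  | (inl r, inl c) => (c - r)%R < k
  | (inr u, inr v) => (u, v) \in P
  | _ => false
  end.

Lemma extend_cell_inl P r c :
  extend_cell P (inl r, inl c) = ((c - r)%R < k).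
Proof. by []. Qed.

Definition extend_cells P : {set T * T} := [set x | extend_cell P x].

Definition corner (Q : {set T * T}) : {set U * U} :=
  [set x | (inr x.1, inr x.2) \in Q].

Lemma card_corner (Q : {set T * T}) :
    (forall x, x \in Q -> exists u v, x = (inr u, inr v)) ->
  #|corner Q| = #|Q|.
Proof.
move=> Qinr; pose f (x : U * U) : T * T := (inr x.1, inr x.2).
have f_inj : injective f by case=> [u v] [u' v'] [-> ->].
rewrite -(card_imset _ f_inj); apply: eq_card => x.
apply/imsetP/idP => [[[u v] + ->]|xQ]; first by rewrite inE.
by have [u [v xE]] := Qinr x xQ; exists (u, v); rewrite ?inE -?xE.
Qed.

(** As [k <= w], the selected diagonals carry no new symbol. So every selected cell with a new row,
    column or symbol lies in the corner. *)
Lemma plex_corner A P (Q : {set T * T}) c : Q \subset extend_cells P ->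
  plex (extend A) c Q -> plex A c (corner Q).
Proof.
move=> /subsetP QP [Qr Qc Qs].
have inP x y : (x, y) \in Q -> extend_cell P (x, y).
  by move=> /QP; rewrite inE.
split=> u.
- rewrite -(Qr (inr u)) -card_corner.
    by apply: eq_card => x; rewrite !inE.
  move=> [x y]; rewrite inE /= => /andP[/inP + /eqP xu]; rewrite xu.
  by case: y => // v _; exists u, v.
- rewrite -(Qc (inr u)) -card_corner.
    by apply: eq_card => x; rewrite !inE.
  move=> [x y]; rewrite inE /= => /andP[/inP + /eqP yu]; rewrite yu.
  by case: x => // v _; exists v, u.
- rewrite -(Qs (inr u)) -card_corner.
    by apply: eq_card => x; rewrite !inE.
  move=> [x y]; rewrite inE /= => /andP[/inP + /eqP].
  case: x y => [r|v] [c'|v'] //=; last by exists v, v'.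
  by move=> ck; case: insubP => // v; rewrite leqNgt (leq_trans ck).
Qed.

(** Each diagonal [d < k] is a transversal of the old rows, columns and symbols; the new ones are
    counted in the corner. *)
Lemma extend_cells_plex A P : plex A k P -> plex (extend A) k (extend_cells P).
Proof.
move=> Pk.
have kD : #|[set d : 'I_m | d < k]| = k.
  rewrite -sum1dep_card big_mkcond /=.
  rewrite (eq_bigr (fun d : 'I_m => 0 <= d < k : nat)) ?sum_interval;
    first by lia.
  by move=> d _; rewrite leq0n; case: ifP.
have cardD (g : 'I_m -> T * T) (q : T * T -> bool) : injective g ->
    (forall x, extend_cell P x && q x -> exists2 d : 'I_m, d < k & x = g d) ->
    (forall d : 'I_m, d < k -> extend_cell P (g d) && q (g d)) ->
  #|[set x in extend_cells P | q x]| = k.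
  move=> g_inj gE gP; rewrite -[RHS]kD -(card_imset _ g_inj).
  apply: eq_card => x; rewrite !inE; apply/idP/imsetP => [/gE[d dk ->]|].
    by exists d; rewrite ?inE.
  by case=> d; rewrite inE => /gP gd ->.
have [corner_row corner_col corner_sym] : plex A k (corner (extend_cells P)).
  by have -> : corner (extend_cells P) = P by apply/setP=> -[u v]; rewrite !inE.
have cardU (q : T * T -> bool) (q' : U * U -> bool) :
    (forall x, extend_cell P x && q x -> exists u v, x = (inr u, inr v)) ->
    (forall x, q (inr x.1, inr x.2) = q' x) ->
  #|[set x in extend_cells P | q x]| =
  #|[set x in corner (extend_cells P) | q' x]|.
  move=> qU qE; rewrite -card_corner => [|x]; last first.
    by rewrite !inE => /qU.
  by apply: eq_card => x; rewrite !inE qE.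
have inlI : injective (@inl 'I_m U) by move=> a b [].
split=> [[r|u]|[c|u]|[s|u]].
- apply: (cardD (fun d => (inl r, inl (r + d)%R))) => [d d'|[x y]|d dk].
  + by move/(congr1 snd)/inlI/addrI.
  + case/andP=> /= + /eqP xr; rewrite xr; case: y => // c ck.
    by exists (c - r)%R; rewrite // addrC subrK.
  + by apply/andP; split=> //; rewrite extend_cell_inl (addrC r) addrK.
- rewrite (cardU _ (fun x => x.1 == u)) //.
  move=> [x y] /andP[/= + /eqP xu]; rewrite xu.
  by case: y => // v _; exists u, v.
- apply: (cardD (fun d => (inl (c - d)%R, inl c))) => [d d'|[x y]|d dk].
  + by move/(congr1 fst)/inlI/addrI/oppr_inj.
  + case/andP=> /= + /eqP yc; rewrite yc; case: x => // r ck.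
    by exists (c - r)%R; rewrite // subKr.
  + by apply/andP; split=> //; rewrite extend_cell_inl subKr.
- rewrite (cardU _ (fun x => x.2 == u)) //.
  move=> [x y] /andP[/= + /eqP yu]; rewrite yu.
  by case: x => // v _; exists v, u.
- apply: (cardD (fun d => (inl (s - row_shift d)%R,
                           inl (s - row_shift d + d)%R))) => [d d'|[x y]|d dk].
  + by move/(congr1 fst)/inlI/addrI/oppr_inj/row_shift_inj.
  + case: x y => [r|v] [c|v'] //=; last by case/andP=> _ /eqP.
    case/andP=> ck.
    case: insubP => [v|_ /eqP/inlI sE]; first by rewrite leqNgt (leq_trans ck).
    exists (c - r)%R => //.
    by rewrite -sE addrK addrC subrK.
  + apply/andP; split; first by rewrite extend_cell_inl (addrC _ d) addrK.
    have := extend_small A (s - row_shift d)%R (leq_trans dk le_kw).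
    by rewrite subrK => E; apply/eqP.
- rewrite (cardU _ (fun x => A x.1 x.2 == u)) //.
  case=> [[r|v] [c|v']] //=; last by exists v, v'.
  by case/andP=> ck; case: insubP => // v; rewrite leqNgt (leq_trans ck).
Qed.

Lemma extend_indivisible :
  has_indivisible_plex U k -> has_indivisible_plex T k.
Proof.
move=> [A [Alatin [P [Pk Pind]]]].
exists (extend A); split; first exact: extend_latin.
exists (extend_cells P); split; first exact: extend_cells_plex.
move=> c Q ck QP Qc; apply: (Pind c (corner Q) ck).
  by apply/subsetP=> -[u v]; rewrite inE => /(subsetP QP); rewrite inE.
exact: plex_corner QP Qc.
Qed.

End Extension.

(** * Existence for all orders from [5k] on *)

Lemma has_indivisible_plex_extend t n k : 0 < t -> t + (t + k) <= n ->
  has_indivisible_plex 'I_t k -> has_indivisible_plex 'I_n k.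
Proof.
(* With [m = n - t], exactly [m - w = t] diagonals are left for the symbols of the corner. *)
move=> t0 tkn It; pose w := n - t - t.
have w_le : w <= (n - t).-1 by rewrite /w; lia.
have k_le : k <= w by rewrite /w; lia.
have cardU : #|{: {d : 'I_(n - t).-1.+1 | w <= d}}| = t.
  rewrite card_sig -sum1_card big_mkcond /=.
  rewrite (eq_bigr (fun d : 'I_(n - t).-1.+1 => w <= d < (n - t).-1.+1 : nat)).
    by rewrite sum_interval minnn /w; lia.
  by move=> d _; rewrite inE ltn_ord andbT; case: ifP.
apply: (has_indivisible_plex_card _ (extend_indivisible w_le k_le _)).
  by rewrite card_sum cardU !card_ord; lia.
by apply: has_indivisible_plex_card It; rewrite cardU card_ord.
Qed.

Lemma has_indivisible_plex_small k : 0 < k ->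
  exists t, 0 < t <= 2 * k /\ has_indivisible_plex 'I_t k.
Proof.
move=> k0; have [k1|k1] := eqVneq k 1.
  (* The odd construction needs [0 < h], so [k = 1] uses the one-cell square. *)
  exists 1; split; first by lia.
  exists (fun _ _ => ord0); split.
    by split=> [r c c'|c r r'] _; rewrite !ord1.
  exists setT; split; last by move=> c Q; lia.
  have card1 (q : pred ('I_1 * 'I_1)) :
      (forall x, q x) -> #|[set x in setT | q x]| = k.
    move=> qT; rewrite k1 (_ : [set x in setT | q x] = setT).
      by rewrite cardsT card_prod card_ord.
    by apply/setP=> x; rewrite !inE qT.
  by split=> i; apply: card1 => x; rewrite ord1 [X in _ == X]ord1.
exists (2 * k); split; first by lia.
have [kO|kE] := boolP (odd k).
  have [h h0 ->] : exists2 h, 0 < h & k = (2 * h).+1 by exists k./2; lia.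
  apply: (@has_indivisible_plex_card 'I_(4 * h).+2).
    by rewrite !card_ord; lia.
  exists (@odd_square h); split; first exact: odd_latin.
  by exists (odd_cells h); exact: odd_indivisible.
have [h ->] : exists h, k = h.*2.+2 by exists k./2.-1; lia.
apply: (@has_indivisible_plex_card ('I_h.*2.+2 * bool)%type).
  by rewrite card_prod card_bool !card_ord mulnC.
exists (@even_square h); split; first exact: even_latin.
by exists [set x | even_cells x.1 x.2]; exact: even_indivisible.
Qed.

Theorem theorem5p5 (n k : nat) :
  0 < n -> 0 < k -> 5 * k <= n ->
  exists L : 'I_n -> 'I_n -> 'I_n,
    latin_square L /\ exists P : {set 'I_n * 'I_n}, indivisible_plex L k P.
Proof.
move=> n0 k0 kn.
have [t [/andP[t0 tk] It]] := has_indivisible_plex_small k0.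
by apply: has_indivisible_plex_extend It => //; lia.
Qed.
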